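(* The width of the largest always graphic interval for $t$-uniform hypergraphic degree sequences goes to $0$ as $t\to\infty$. That is, if $w(t)$ denotes the supremum of $b-a$ over all always graphic intervals $[a,b]$ for $t$-uniformity, then $w(t)\to 0$ as $t\to\infty$.
   Context: A hypergraph $H=(V,E)$ is $t$-uniform if $E\subseteq\binom{V}{t}$; the degree $d(v)$ of a vertex is the number of hyperedges containing it. A degree sequence $D=(d_1,\dots,d_n)$ (of non-negative integers) has a $t$-uniform hypergraph realization if there is a $t$-uniform hypergraph on $v_1,\dots,v_n$ with $d(v_i)=d_i$ for all $i$. An interval $[a,b]$ with $0\le a\le b\le 1$ is an always graphic interval for $t$-uniformity if for all sufficiently large $n$, every degree sequence $D=(d_1,\dots,d_n)$ of length $n$ with $a\binom{n-1}{t-1}\le d_i\le b\binom{n-1}{t-1}$ for all $i$ and $\sum_i d_i\equiv 0\pmod t$ has a $t$-uniform hypergraph realization. Its width is $b-a$. *)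

(* Defs.v *)
From mathcomp Require Import all_boot all_order all_algebra.
From mathcomp Require Import all_classical all_reals all_analysis.

Set Implicit Arguments.
Unset Strict Implicit.
Unset Printing Implicit Defensive.

Import Order.TTheory GRing.Theory Num.Theory.
Import numFieldNormedType.Exports.

Local Open Scope classical_set_scope.
Local Open Scope ring_scope.

Definition uniform_hypergraph (V : finType) (t : nat) (E : {set {set V}}) : Prop :=
  {in E, forall e : {set V}, #|e| = t}.

Definition degree (V : finType) (E : {set {set V}}) (v : V) : nat :=
  #|[set e in E | v \in e]|.

Definition hypergraphic (t n : nat) (D : 'I_n -> nat) : Prop :=
  exists2 E : {set {set 'I_n}},
    uniform_hypergraph t E & forall i, degree E i = D i.

Definition always_graphic (R : realType) (t : nat) (a b : R) : Prop :=
  [/\ 0 <= a, a <= b, b <= 1 &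
    \forall n \near \oo, forall D : 'I_n -> nat,
      (forall i, a * 'C(n.-1, t.-1)%:R <= (D i)%:R <= b * 'C(n.-1, t.-1)%:R) ->
      (\sum_(i < n) D i = 0 %[mod t])%N ->
      hypergraphic t D].

Definition always_graphic_widths (R : realType) (t : nat) : set R :=
  [set w | exists a b : R, always_graphic t a b /\ w = b - a].

Arguments always_graphic_widths R t : clear implicits.

Definition max_width (R : realType) (t : nat) : R :=
  sup (always_graphic_widths R t).

(* [sup] returns the junk value 0 on empty or unbounded sets; this lemma rules
   that case out for every t. *)
Lemma has_sup_always_graphic_widths (R : realType) (t : nat) :
  has_sup (always_graphic_widths R t).
Proof.
split; last first.
  exists 1 => w [a [b [[a0 _ b1 _] ->]]].
  by rewrite lerBlDr (le_trans b1)// lerDl.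
exists 0, 0, 0; split; last by rewrite subrr.
split => //; near=> n => D D0 _; exists finset.set0 => [e|i].
  by rewrite finset.in_set0.
have := D0 i; rewrite !mul0r -eq_le eq_sym pnatr_eq0 => /eqP ->.
by apply/eqP; rewrite /degree cards_eq0; apply/eqP/setP => e; rewrite !inE.
Unshelve. all: by end_near. Qed.

(* Main.v *)
(* Split [2m] vertices into halves carrying weights [1] and [-1], and give them
   degrees close to [b C] and [a C], where [C = 'C(2m - 1, t - 1)].  In a
   realization the weighted degree sum, about [m (b - a) C], is the sum over
   the edges of their total weights.  Because the weights sum to zero, the
   total weight of a random [t]-set has variance at most [t], so that sum is
   O(sqrt t) 'C(2m, t) = O(m C / sqrt t), whence [b - a = O(1 / sqrt t)]. *)

Require Import Defs.
From mathcomp Require Import all_boot all_order all_algebra.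
From mathcomp Require Import all_classical all_reals all_analysis.
From mathcomp Require Import ring lra zify.

Set Implicit Arguments.
Unset Strict Implicit.
Unset Printing Implicit Defensive.

Import Order.TTheory GRing.Theory Num.Theory.
Import numFieldNormedType.Exports.

Local Open Scope ring_scope.

Lemma leq_bin_self n k : (0 < k < n)%N -> (n <= 'C(n, k))%N.
Proof.
elim: n k => [|n IHn] [|k]; rewrite ?andbF //= ltnS binS leq_eqVlt.
case/predU1P => [<-|kn]; first by rewrite binSn binn.
by rewrite -(addn1 n) leq_add ?bin_gt0 ?IHn //; do 2 apply: ltnW.
Qed.

(** Adding [S] is a bijection from the subsets of size [t - #|S|] of the complement of [S] onto the
    [t]-sets containing [S]. *)
Lemma card_uniform_supersets (V : finType) (t : nat) (S : {set V}) :
  (#|S| <= t)%N ->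
  #|[set e : {set V} | (#|e| == t) && (S \subset e)]| = 'C(#|V| - #|S|, t - #|S|).
Proof.
move=> St; have <- : #|~: S| = (#|V| - #|S|)%N by rewrite cardsCs finset.setCK.
rewrite -cards_draws; set D := (X in _ = #|pred_of_set X|).
rewrite -(card_in_imset (D := D) (f := fun A => A :|: S)); last first.
  move=> A B /[!inE] /andP[+ _] /andP[+ _]; rewrite -!finset.disjoints_subset.
  move=> AS BS /setP AB; apply/setP => x; have := AB x.
  rewrite !inE; have [xS|] := boolP (x \in S); last by rewrite !orbF.
  by rewrite (disjointFl AS xS) (disjointFl BS xS).
apply: eq_card => e; rewrite inE; apply/andP/imsetP => [[/eqP et Se]|[A]].
  exists (e :\: S).
    by rewrite inE finset.subsetDr cardsD (finset.setIidPr Se) et eqxx.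
  by rewrite finset.setUC -{1}(finset.setIidPr Se) finset.setID.
rewrite inE -finset.disjoints_subset => /andP[AS /eqP At] ->.
rewrite finset.subsetUr; split=> //.
by rewrite cardsU disjoint_setI0// finset.cards0 subn0 At subnK.
Qed.

Lemma sum_weight_degree (R : pzRingType) (V : finType) (E : {set {set V}})
    (w : V -> R) :
  \sum_v w v * (degree E v)%:R = \sum_(e in E) \sum_(v in e) w v.
Proof.
rewrite (exchange_big_dep predT) //=; apply: eq_bigr => v _.
rewrite /degree sumr_const mulr_natr; congr (_ *+ _).
by apply: eq_card => e; rewrite !inE.
Qed.

(** Expanding the square gives a quadratic form in [w] whose coefficients [N u v] take only two
    values, one on the diagonal and one off it. As [w] sums to zero, the off-diagonal part is a
    nonpositive multiple of [\sum_v w v ^+ 2], and the diagonal part is the bound. *)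
Lemma second_moment_weight (R : realDomainType) (V : finType) (t : nat)
    (w : V -> R) : (1 < t)%N -> \sum_v w v = 0 ->
  \sum_(e : {set V} | #|e| == t) (\sum_(v in e) w v) ^+ 2
    <= 'C(#|V|.-1, t.-1)%:R * \sum_v w v ^+ 2.
Proof.
move=> t1 w0.
pose N u v := #|[set e : {set V} | (#|e| == t) && ([set u; v] \subset e)]|.
have Neq u : N u u = 'C(#|V|.-1, t.-1).
  by rewrite /N finset.setUid card_uniform_supersets cards1 ?subn1// ltnW.
have Nneq u v : v != u -> N u v = 'C(#|V| - 2, t - 2).
  by move=> vu; rewrite /N card_uniform_supersets cards2 eq_sym vu.
have -> : \sum_(e : {set V} | #|e| == t) (\sum_(v in e) w v) ^+ 2
    = \sum_u \sum_v w u * w v * (N u v)%:R.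
  under eq_bigr do rewrite expr2 big_distrlr /=.
  rewrite (exchange_big_dep predT) //=; apply: eq_bigr => u _.
  rewrite (exchange_big_dep predT) //=; apply: eq_bigr => v _.
  rewrite sumr_const mulr_natr; congr (_ *+ _).
  apply: eq_card => e.
  by rewrite !inE finset.subUset !finset.sub1set unfold_in /= -andbA.
set c2 := 'C(#|V| - 2, t - 2) in Nneq.
rewrite mulr_sumr; apply: ler_sum => u _.
rewrite (bigD1 u) //= Neq.
under eq_bigr => v vu do rewrite (Nneq _ _ vu) -mulrA mulrCA.
rewrite -mulr_suml.
(* The off-diagonal terms of row [u] thus add up to [- c2 * w u ^+ 2]. *)
have -> : \sum_(v | v != u) w v = - w u.
  by apply/eqP; rewrite -addr_eq0 addrC; move/eqP: w0; rewrite (bigD1 u).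
rewrite -expr2 mulrC gerDl mulNr oppr_le0 mulrCA mulrA -expr2.
by rewrite mulr_ge0 ?sqr_ge0.
Qed.

(* [x <= l x^2 + 1 / (4 l)] replaces Cauchy-Schwarz, and extends the sum from
   the edges to all [t]-sets. *)
Lemma uniform_weight_degree_le (R : realFieldType) (V : finType) (t : nat)
    (E : {set {set V}}) (w : V -> R) (l : R) :
  (1 < t)%N -> 0 < l -> uniform_hypergraph t E -> \sum_v w v = 0 ->
  \sum_v w v * (degree E v)%:R <=
    l * 'C(#|V|.-1, t.-1)%:R * \sum_v w v ^+ 2 + 'C(#|V|, t)%:R / (4 * l).
Proof.
move=> t1 l0 Et w0; rewrite sum_weight_degree.
have amgm x : x <= l * x ^+ 2 + (4 * l)^-1.
  rewrite -subr_ge0.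
  have -> : l * x ^+ 2 + (4 * l)^-1 - x = l * (x - (2 * l)^-1) ^+ 2.
    by field; rewrite gt_eqF.
  by rewrite mulr_ge0 ?sqr_ge0 // ltW.
apply: (@le_trans _ _ (\sum_(e : {set V} | #|e| == t)
    (l * (\sum_(v in e) w v) ^+ 2 + (4 * l)^-1))).
  rewrite [leRHS](bigID (mem E)) /= -[leLHS]addr0 lerD //; last first.
    apply: sumr_ge0 => e _.
    by rewrite addr_ge0 ?invr_ge0 ?(mulr_ge0 _ (sqr_ge0 _)) ?mulr_ge0 // ltW.
  under [leRHS]eq_bigl => e.
    rewrite (_ : _ && _ = (e \in E)); first by over.
    by case: (boolP (e \in E)) => [/Et ->|_]; rewrite ?eqxx ?andbF.
  exact: ler_sum.
rewrite big_split /= -mulr_sumr lerD //.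
  by rewrite -mulrA ler_wpM2l ?second_moment_weight // ltW.
by rewrite sumr_const -card_draws cardsE -[leLHS]mulr_natl.
Qed.

(** Degrees that are all multiples of [t] meet the divisibility condition on their sum, at a
    rounding cost of at most [t] each. *)
Lemma floor_multiple (R : archiRealFieldType) (t : nat) (x : R) :
  (0 < t)%N -> 0 <= x ->
  exists2 k, (t %| k)%N & x - t%:R < k%:R <= x.
Proof.
move=> t0 x0; have t0R : 0 < t%:R :> R by rewrite ltr0n.
exists (t * Num.truncn (x / t%:R))%N; first exact: dvdn_mulr.
rewrite natrM mulrC ltrBlDr -[X in _ + X]mul1r -mulrDl natr1.
by rewrite -ltr_pdivrMr // truncnS_gt -ler_pdivlMr // truncn_le divr_ge0 // ltW.
Qed.

Lemma ceil_multiple (R : archiRealFieldType) (t : nat) (x : R) :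
  (0 < t)%N -> 0 <= x ->
  exists2 k, (t %| k)%N & x < k%:R <= x + t%:R.
Proof.
move=> t0 x0; have [k tk /andP[xk kx]] := floor_multiple t0 x0.
exists (k + t)%N; first by rewrite dvdn_addl.
by rewrite natrD -ltrBlDr xk lerD2r.
Qed.

(** Leaving [l] free avoids square roots; the best choice, [l = 1 / (2 sqrt t)], would give
    [2 / sqrt t]. *)
Lemma always_graphic_width_le (R : realType) (t : nat) (a b l : R) :
  (1 < t)%N -> 0 < l -> always_graphic t a b ->
  b - a <= 2 * l + (2 * l * t%:R)^-1.
Proof.
move=> t1 l0 [a0 ab b1 [N _ graphic]]; rewrite leNgt -subr_gt0; apply/negP.
set d := _ - (2 * l + _) => d0.
have t0 : 0 < t%:R :> R by rewrite ltr0n ltnW.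
have q0 : 0 < (2 * l * t%:R)^-1 :> R by rewrite invr_gt0 !mulr_gt0.
(* [N <= m] makes [2m] vertices enough for [graphic], [t <= m] gives [m <= c] below, and the last
   bound lets the excess [d * c] beat the rounding loss [2t]. *)
have [m [Nm tm dm]] : exists m, [/\ (N <= m)%N, (t <= m)%N & 2 * t%:R < d * m%:R].
  exists (N + t + (Num.truncn (2 * t%:R / d)).+1)%N.
  split; [by rewrite -addnA leq_addr|by rewrite addnAC leq_addl|].
  rewrite -ltr_pdivrMl // mulrC (lt_le_trans (truncnS_gt _)) // ler_nat.
  exact: leq_addl.
have m0 : (0 < m)%N by lia.
have [c cE] : exists c, c = 'C((m + m).-1, t.-1) by eexists.
have mc : (m <= c)%N.
  rewrite cE; apply: (@leq_trans (m + m).-1); first by lia.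
  by apply: leq_bin_self; lia.
have dc : 2 * t%:R < d * c%:R.
  by rewrite (lt_le_trans dm) // ler_pM2l // ler_nat.
have [hi thi /andP[hi_gt hi_le]] : exists2 k, (t %| k)%N &
    b * c%:R - t%:R < k%:R <= b * c%:R.
  by apply: floor_multiple; [exact: ltnW|rewrite mulr_ge0 // (le_trans a0)].
have [lo tlo /andP[lo_gt lo_le]] : exists2 k, (t %| k)%N &
    a * c%:R < k%:R <= a * c%:R + t%:R.
  by apply: ceil_multiple; rewrite ?mulr_ge0 // ltnW.
have gap : d * c%:R + 2 * l * c%:R + (2 * l * t%:R)^-1 * c%:R = b * c%:R - a * c%:R.
  by rewrite /d; ring.
clearbody d.
have lc0 : 0 <= 2 * l * c%:R by rewrite !mulr_ge0 // ltW.
have qc0 : 0 <= (2 * l * t%:R)^-1 * c%:R by rewrite mulr_ge0 // ltW.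
pose D (i : 'I_(m + m)) := if (i < m)%N then hi else lo.
pose w (i : 'I_(m + m)) : R := if (i < m)%N then 1 else -1.
have [|i||E Et ED] := graphic (m + m)%N _ D.
- exact: leq_trans Nm (leq_addr _ _).
(* By [gap] and [dc], [b * c] exceeds [a * c] by more than [2t], so neither rounded degree leaves
   the interval. *)
- rewrite /D -cE; case: ifP => _; apply/andP; split; lra.
- apply/eqP; rewrite mod0n; apply: dvdn_sum => i _.
  by rewrite /D; case: ifP.
have sumw (F : bool -> R) : \sum_(i < m + m) F (i < m)%N = m%:R * (F true + F false).
  rewrite big_split_ord /= mulrDr.
  under eq_bigr => i _ do rewrite ltn_ord.
  under [X in _ + X]eq_bigr => i _ do rewrite ltnNge leq_addr.
  by rewrite !sumr_const card_ord !mulr_natl.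
have := @uniform_weight_degree_le R 'I_(m + m) t E w l t1 l0 Et.
under [X in _ -> X <= _]eq_bigr => i _ do rewrite ED.
rewrite (sumw (fun x => if x then 1 else -1)) subrr mulr0 => /(_ erefl).
have -> : \sum_i w i * (D i)%:R = m%:R * (hi%:R - lo%:R).
  rewrite -mulN1r -[hi%:R]mul1r -(sumw (fun x => if x then 1 * hi%:R else -1 * lo%:R)).
  by apply: eq_bigr => i _; rewrite /w /D; case: ifP.
have -> : \sum_i w i ^+ 2 = m%:R * 2.
  rewrite -(sumw (fun=> 1)).
  by apply: eq_bigr => i _; rewrite /w; case: ifP; rewrite ?sqrrN expr1n.
rewrite card_ord -cE.
(* The identity [t 'C(2m, t) = 2m c] makes every term a multiple of [m], which then cancels. *)
have -> : 'C(m + m, t)%:R = m%:R * 2 * c%:R / t%:R :> R.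
  have ct : ('C(m + m, t) * t = (m + m) * c)%N.
    by rewrite cE mul_bin_diag prednK 1?mulnC // ltnW.
  apply: (mulIf (lt0r_neq0 t0)); rewrite divfK ?lt0r_neq0 //.
  by rewrite -[LHS]natrM ct natrM natrD; ring.
have -> : l * c%:R * (m%:R * 2) + m%:R * 2 * c%:R / t%:R / (4 * l)
    = m%:R * (2 * l * c%:R + (2 * l * t%:R)^-1 * c%:R).
  by field; rewrite !lt0r_neq0.
(* The remaining upper bound on [hi - lo] contradicts [hi - lo > (b - a) c - 2t], by [gap] and
   [dc]. *)
rewrite ler_pM2l ?ltr0n //; lra.
Qed.

Local Open Scope classical_set_scope.

Theorem corollary5p2 (R : realType) :
  max_width R t @[t --> \oo] --> (0 : R).
Proof.
apply/cvgr0Pnorm_le => e e0.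
near=> t.
have t1 : (1 < t)%N by near: t; exact: nbhs_infty_gt.
(* With [l = e / 4] the width bound is [e / 2 + 2 / (e t)], and this threshold makes the second term
   at most [e / 2]. *)
have te : 16 / e ^+ 2 <= t%:R by near: t; exact: nbhs_infty_ger.
have [[v [a [b [agab vE]]]] hub] := has_sup_always_graphic_widths R t.
have v0 : 0 <= v by rewrite vE subr_ge0; case: agab.
rewrite ger0_norm; last first.
  by apply: (le_trans v0); apply: ub_le_sup => //; exists a, b.
apply: ge_sup; first by exists v, a, b.
move=> _ [a' [b' [ag ->]]].
have := @always_graphic_width_le R t a' b' (e / 4) t1 _ ag.
rewrite divr_gt0 // => /(_ erefl) /le_trans; apply.
suff : (2 * (e / 4) * t%:R)^-1 <= e / 2 by lra.
rewrite invf_ple ?posrE ?divr_gt0 ?mulr_gt0 ?divr_gt0 ?ltr0n ?(ltnW t1) //.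
move: te; rewrite ler_pdivrMr ?exprn_gt0 // => te.
rewrite invf_div ler_pdivrMr //; lra.
Unshelve. all: by end_near. Qed.
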